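(* Let $B_{\mathbb{H}}\colon\mathbb{O}\times\mathbb{O}\to\mathbb{H}$, $B_{\mathbb{H}}(x,y)=\operatorname{Qu}(x\overline{y})$. For $q,p\in S^3$ define $\rho_{q,p}\colon\mathbb{O}\to\mathbb{O}$ by $\rho_{q,p}(a+be_4)=R_qa+(L_pb)e_4=aq+(pb)e_4$ for $a,b\in\mathbb{H}$. Then $B_{\mathbb{H}}(\rho_{q,p}x,\rho_{q,p}y)=B_{\mathbb{H}}(x,y)$ for all $x,y\in\mathbb{O}$ and all $q,p\in S^3$; hence, with $S^3_R\times S^3_L$ acting on $\mathbb{O}$ through $\rho$, \[ S^3_R\times S^3_L\subset\mathcal{G}(B_{\mathbb{H}}). \]
   Context: Let $\mathbb{H}$ be the quaternions with conjugation $a\mapsto\overline{a}$. The octonions $\mathbb{O}$ are $\mathbb{H}\oplus\mathbb{H}$ with the multiplication $(a,b)(c,d)=(ac-\overline{d}b,\ da+b\overline{c})$ and the conjugation $\overline{(a,b)}=(\overline{a},-b)$. With $a\in\mathbb{H}$ identified with $(a,0)$ and $e_4=(0,1)$, one has $(a,b)=a+be_4$. The quaternion part is $\operatorname{Qu}(a+be_4)=a$. $S^3=\{q\in\mathbb{H}:q\overline{q}=\overline{q}q=1\}$. For $q\in S^3$, $L_q,R_q\colon\mathbb{H}\to\mathbb{H}$ are $L_q(a)=qa$ and $R_q(a)=aq$; $S^3_L=\{L_q:q\in S^3\}$ and $S^3_R=\{R_q:q\in S^3\}$ are groups under composition. $\operatorname{GL}(\mathbb{O})$ is the group of invertible real linear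 maps $\mathbb{O}\to\mathbb{O}$, and for a real bilinear function $B$ on $\mathbb{O}\times\mathbb{O}$, $\mathcal{G}(B)=\{T\in\operatorname{GL}(\mathbb{O}):B(Tx,Ty)=B(x,y)\ \forall x,y\in\mathbb{O}\}$. *)

(* Defs.v *)
From HB Require Import structures.
From mathcomp Require Import all_boot all_order all_algebra ring.
From mathcomp Require Import boolp reals.

Set Implicit Arguments.
Unset Strict Implicit.
Unset Printing Implicit Defensive.

Import GRing.Theory.
Local Open Scope ring_scope.

Record quaternion (R : Type) := Quaternion {qre : R; qi : R; qj : R; qk : R}.

Section QuaternionAlgebra.
Variable R : realType.
Local Notation H := (quaternion R).

Definition quat_to_tuple (x : H) := (qre x, qi x, qj x, qk x).
Definition tuple_to_quat (t : R * R * R * R) : H :=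
  let: (a, b, c, d) := t in Quaternion a b c d.
Lemma quat_to_tupleK : cancel quat_to_tuple tuple_to_quat.
Proof. by case. Qed.
HB.instance Definition _ := Choice.copy H (can_type quat_to_tupleK).

Definition quat0 : H := Quaternion 0 0 0 0.
Definition quat_opp (x : H) : H :=
  Quaternion (- qre x) (- qi x) (- qj x) (- qk x).
Definition quat_add (x y : H) : H :=
  Quaternion (qre x + qre y) (qi x + qi y) (qj x + qj y) (qk x + qk y).

Lemma quat_addA : associative quat_add.
Proof. by case=> ? ? ? ? [? ? ? ?] [? ? ? ?]; congr Quaternion; rewrite /= addrA. Qed.
Lemma quat_addC : commutative quat_add.
Proof. by case=> ? ? ? ? [? ? ? ?]; congr Quaternion; rewrite /= addrC. Qed.
Lemma quat_add0 : left_id quat0 quat_add.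
Proof. by case=> ? ? ? ?; congr Quaternion; rewrite /= add0r. Qed.
Lemma quat_addN : left_inverse quat0 quat_opp quat_add.
Proof. by case=> ? ? ? ?; congr Quaternion; rewrite /= addNr. Qed.
HB.instance Definition _ :=
  GRing.isZmodule.Build H quat_addA quat_addC quat_add0 quat_addN.

(* The real span of 1, i, j, k with i^2 = j^2 = k^2 = ijk = -1. *)
Definition quat1 : H := Quaternion 1 0 0 0.
Definition quat_mul (x y : H) : H :=
  Quaternion
    (qre x * qre y - qi x * qi y - qj x * qj y - qk x * qk y)
    (qre x * qi y + qi x * qre y + qj x * qk y - qk x * qj y)
    (qre x * qj y - qi x * qk y + qj x * qre y + qk x * qi y)
    (qre x * qk y + qi x * qj y - qj x * qi y + qk x * qre y).

Lemma quat_mulA : associative quat_mul.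
Proof. by case=> ? ? ? ? [? ? ? ?] [? ? ? ?]; congr Quaternion => /=; ring. Qed.
Lemma quat_mul1 : left_id quat1 quat_mul.
Proof. by case=> ? ? ? ?; congr Quaternion => /=; ring. Qed.
Lemma quat_mulr1 : right_id quat1 quat_mul.
Proof. by case=> ? ? ? ?; congr Quaternion => /=; ring. Qed.
Lemma quat_mulDl : left_distributive quat_mul +%R.
Proof. by case=> ? ? ? ? [? ? ? ?] [? ? ? ?]; congr Quaternion => /=; ring. Qed.
Lemma quat_mulDr : right_distributive quat_mul +%R.
Proof. by case=> ? ? ? ? [? ? ? ?] [? ? ? ?]; congr Quaternion => /=; ring. Qed.
Lemma quat1_neq0 : quat1 != 0.
Proof. by apply/eqP => -[] /eqP; rewrite oner_eq0. Qed.
HB.instance Definition _ := GRing.Zmodule_isNzRing.Build H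
  quat_mulA quat_mul1 quat_mulr1 quat_mulDl quat_mulDr quat1_neq0.

Definition quat_scale (t : R) (x : H) : H :=
  Quaternion (t * qre x) (t * qi x) (t * qj x) (t * qk x).
Lemma quat_scaleA t u x : quat_scale t (quat_scale u x) = quat_scale (t * u) x.
Proof. by case: x => ? ? ? ?; congr Quaternion => /=; ring. Qed.
Lemma quat_scale1 : left_id 1 quat_scale.
Proof. by case=> ? ? ? ?; congr Quaternion => /=; ring. Qed.
Lemma quat_scaleDr : right_distributive quat_scale +%R.
Proof. by move=> ? [? ? ? ?] [? ? ? ?]; congr Quaternion => /=; ring. Qed.
Lemma quat_scaleDl x : {morph quat_scale^~ x : t u / t + u}.
Proof. by case: x => ? ? ? ? t u; congr Quaternion => /=; ring. Qed.
HB.instance Definition _ := GRing.Zmodule_isLmodule.Build R H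
  quat_scaleA quat_scale1 quat_scaleDr quat_scaleDl.

Lemma quat_scaleAl (t : R) (x y : H) : t *: (x * y) = t *: x * y.
Proof. by case: x y => ? ? ? ? [? ? ? ?]; congr Quaternion => /=; ring. Qed.
HB.instance Definition _ := GRing.Lmodule_isLalgebra.Build R H quat_scaleAl.
Lemma quat_scaleAr (t : R) (x y : H) : t *: (x * y) = x * (t *: y).
Proof. by case: x y => ? ? ? ? [? ? ? ?]; congr Quaternion => /=; ring. Qed.
HB.instance Definition _ := GRing.Lalgebra_isAlgebra.Build R H quat_scaleAr.

Definition qconj (x : H) : H := Quaternion (qre x) (- qi x) (- qj x) (- qk x).

Lemma qconj_linear : linear qconj.
Proof. by move=> t [? ? ? ?] [? ? ? ?]; congr Quaternion => /=; ring. Qed.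
HB.instance Definition _ := GRing.isLinear.Build R H H *:%R qconj qconj_linear.

Lemma qconjM x y : qconj (x * y) = qconj y * qconj x.
Proof. by case: x y => ? ? ? ? [? ? ? ?]; congr Quaternion => /=; ring. Qed.
Lemma qconjK : involutive qconj.
Proof. by case=> ? ? ? ?; rewrite /qconj /= !opprK. Qed.
Lemma qconj1 : qconj 1 = 1.
Proof. by rewrite /qconj /= !oppr0. Qed.

End QuaternionAlgebra.

(* A record rather than an alias of the product: the canonical multiplication *)
(* on a product type is componentwise.                                        *)
Record octonion (R : Type) :=
  Octonion {oct1 : quaternion R; oct2 : quaternion R}.

Section Octonions.
Variable R : realType.
Local Notation H := (quaternion R).
Local Notation O := (octonion R).

Definition oct_to_pair (x : O) := (oct1 x, oct2 x).
Definition pair_to_oct (t : H * H) : O := Octonion t.1 t.2.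
Lemma oct_to_pairK : cancel oct_to_pair pair_to_oct.
Proof. by case. Qed.
HB.instance Definition _ := Choice.copy O (can_type oct_to_pairK).

Definition oct0 : O := Octonion 0 0.
Definition oct_opp (x : O) : O := Octonion (- oct1 x) (- oct2 x).
Definition oct_add (x y : O) : O :=
  Octonion (oct1 x + oct1 y) (oct2 x + oct2 y).
Lemma oct_addA : associative oct_add.
Proof. by case=> ? ? [? ?] [? ?]; congr Octonion; rewrite /= addrA. Qed.
Lemma oct_addC : commutative oct_add.
Proof. by case=> ? ? [? ?]; congr Octonion; rewrite /= addrC. Qed.
Lemma oct_add0 : left_id oct0 oct_add.
Proof. by case=> ? ?; congr Octonion; rewrite /= add0r. Qed.
Lemma oct_addN : left_inverse oct0 oct_opp oct_add.
Proof. by case=> ? ?; congr Octonion; rewrite /= addNr. Qed.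
HB.instance Definition _ :=
  GRing.isZmodule.Build O oct_addA oct_addC oct_add0 oct_addN.

Definition oct_scale (t : R) (x : O) : O := Octonion (t *: oct1 x) (t *: oct2 x).
Lemma oct_scaleA t u x : oct_scale t (oct_scale u x) = oct_scale (t * u) x.
Proof. by congr Octonion; rewrite /= scalerA. Qed.
Lemma oct_scale1 : left_id 1 oct_scale.
Proof. by case=> ? ?; congr Octonion; rewrite /= scale1r. Qed.
Lemma oct_scaleDr : right_distributive oct_scale +%R.
Proof. by move=> ? [? ?] [? ?]; congr Octonion; rewrite /= scalerDr. Qed.
Lemma oct_scaleDl x : {morph oct_scale^~ x : t u / t + u}.
Proof. by case: x => ? ? t u; congr Octonion; rewrite /= scalerDl. Qed.
HB.instance Definition _ := GRing.Zmodule_isLmodule.Build R O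
  oct_scaleA oct_scale1 oct_scaleDr oct_scaleDl.

Definition omul (x y : O) : O :=
  let: Octonion a b := x in
  let: Octonion c d := y in
  Octonion (a * c - qconj d * b) (d * a + b * qconj c).

Definition oconj (x : O) : O := Octonion (qconj (oct1 x)) (- oct2 x).

Definition oct_of_quat (a : H) : O := Octonion a 0.
Definition e4 : O := Octonion 0 1.
Definition Qu (x : O) : H := oct1 x.

Lemma octonionE a b : Octonion a b = oct_of_quat a + omul (oct_of_quat b) e4.
Proof.
by congr Octonion; rewrite /= ?raddf0 ?(mulr0, mul0r, mul1r, subr0, addr0, add0r).
Qed.

Definition BH (x y : O) : H := Qu (omul x (oconj y)).

Lemma BHE x y : BH x y = oct1 x * qconj (oct1 y) + qconj (oct2 y) * oct2 x.
Proof. by case: x y => a b [c d]; rewrite /BH /= raddfN mulNr opprK. Qed.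

Lemma BH_bilinear :
  bilinear_for ( *:%R : R -> H -> H) ( *:%R : R -> H -> H) BH.
Proof.
split=> z t x y; rewrite !BHE /=.
- rewrite mulrDl mulrDr -scalerAl -scalerAr scalerDr addrACA; congr (_ + _).
- by rewrite !linearP mulrDr mulrDl -scalerAr -scalerAl scalerDr addrACA.
Qed.
HB.instance Definition _ := bilinear_isBilinear.Build R O O H *:%R *:%R BH
  BH_bilinear.

End Octonions.

Arguments e4 {R}.

Section GeneralLinearGroup.
Variables (R : realType) (V : lmodType R).

Record general_linear := GeneralLinear {
  gl_fun :> V -> V;
  gl_subproof : `[< linear gl_fun /\ bijective gl_fun >]
}.
HB.instance Definition _ := [isSub for gl_fun].
HB.instance Definition _ := [Choice of general_linear by <:].

Lemma gl_linear (f : general_linear) : linear f.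
Proof. by have /asboolP[] := gl_subproof f. Qed.
HB.instance Definition _ (f : general_linear) :=
  GRing.isLinear.Build R V V *:%R f (gl_linear f).

Lemma gl_bij (f : general_linear) : bijective f.
Proof. by have /asboolP[] := gl_subproof f. Qed.

Lemma gl_ext (f g : general_linear) : f =1 g -> f = g.
Proof. by move=> fg; apply: val_inj; apply/funext. Qed.

Lemma gl_one_subproof : `[< linear (@idfun V) /\ bijective (@idfun V) >].
Proof. by apply/asboolP; split=> //; exists idfun. Qed.
Definition gl_one := GeneralLinear gl_one_subproof.

Lemma gl_mul_subproof (f g : general_linear) :
  `[< linear (f \o g) /\ bijective (f \o g) >].
Proof.
apply/asboolP; split; first by move=> t x y; rewrite /= !linearP.
by apply: bij_comp; exact: gl_bij.
Qed.
Definition gl_mul f g := GeneralLinear (gl_mul_subproof f g).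

Lemma gl_inv_ex (f : general_linear) :
  exists g : general_linear, cancel f g /\ cancel g f.
Proof.
have [g fK gK] := gl_bij f.
have gP : `[< linear g /\ bijective g >].
  by apply/asboolP; split; [exact: (can2_linear fK gK) | exists (f : V -> V)].
by exists (GeneralLinear gP).
Qed.
Definition gl_inv (f : general_linear) : general_linear := sval (cid (gl_inv_ex f)).
Lemma gl_invK (f : general_linear) : cancel f (gl_inv f).
Proof. by rewrite /gl_inv; case: cid => g []. Qed.
Lemma gl_invVK (f : general_linear) : cancel (gl_inv f) f.
Proof. by rewrite /gl_inv; case: cid => g []. Qed.

Lemma gl_mulA : associative gl_mul.
Proof. by move=> f g h; apply: gl_ext. Qed.
Lemma gl_mul1 : left_id gl_one gl_mul.
Proof. by move=> f; apply: gl_ext. Qed.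
Lemma gl_mulr1 : right_id gl_one gl_mul.
Proof. by move=> f; apply: gl_ext. Qed.
Lemma gl_mulV : left_inverse gl_one gl_inv gl_mul.
Proof. by move=> f; apply: gl_ext => x; exact: gl_invK. Qed.
Lemma gl_mulrV : right_inverse gl_one gl_inv gl_mul.
Proof. by move=> f; apply: gl_ext => x; exact: gl_invVK. Qed.
(* The group law is composition: (f * g) x = f (g x). *)
HB.instance Definition _ := isGroup.Build general_linear
  gl_mulA gl_mul1 gl_mulr1 gl_mulV gl_mulrV.

Lemma glME (f g : general_linear) x : (f * g)%g x = f (g x).
Proof. by []. Qed.
Lemma gl1E x : (1%g : general_linear) x = x.
Proof. by []. Qed.

End GeneralLinearGroup.

(* The group of all T in GL(U) with B (T x) (T y) = B x y, for a real bilinear *)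
(* B on U with values in any real vector space V.                             *)
Section IsometryGroup.
Variables (R : realType) (U V : lmodType R) (B : {bilinear U -> U -> V}).

Definition preserves : {pred general_linear U} :=
  fun T => `[< forall x y, B (T x) (T y) = B x y >].

Record isometry_group := Isometry {
  isometry_val :> general_linear U;
  isometry_subproof : isometry_val \in preserves
}.
HB.instance Definition _ := [isSub for isometry_val].
HB.instance Definition _ := [Choice of isometry_group by <:].

Lemma isometryP (T : isometry_group) x y : B (T x) (T y) = B x y.
Proof. by have /asboolP := isometry_subproof T. Qed.

Lemma preserves_group_closed : group_closed preserves.
Proof.
split=> [|f g /asboolP fP /asboolP gP]; apply/asboolP => // x y.
by rewrite !glME fP -[LHS]gP -!glME divgg.
Qed.
HB.instance Definition _ :=
  SubChoice_isSubGroup.Build _ preserves isometry_group preserves_group_closed.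

End IsometryGroup.

Section UnitQuaternions.
Variable R : realType.
Local Notation H := (quaternion R).
Local Notation O := (octonion R).

Record S3 := UnitQuaternion {
  S3_val :> H;
  S3_subproof : (S3_val * qconj S3_val == 1) && (qconj S3_val * S3_val == 1)
}.
HB.instance Definition _ := [isSub for S3_val].
HB.instance Definition _ := [Choice of S3 by <:].

Lemma S3_mulV (q : S3) : (q : H) * qconj q = 1.
Proof. by have /andP[/eqP] := S3_subproof q. Qed.
Lemma S3_mulrV (q : S3) : qconj q * (q : H) = 1.
Proof. by have /andP[_ /eqP] := S3_subproof q. Qed.

Lemma S3_one_subproof : ((1 : H) * qconj 1 == 1) && (qconj 1 * (1 : H) == 1).
Proof. by rewrite qconj1 mulr1 eqxx. Qed.
Definition S3_one := UnitQuaternion S3_one_subproof.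

Lemma S3_mul_subproof (q p : S3) :
  ((q : H) * p * qconj ((q : H) * p) == 1) &&
  (qconj ((q : H) * p) * ((q : H) * p) == 1).
Proof.
rewrite qconjM -mulrA [(p : H) * _]mulrA S3_mulV mul1r S3_mulV.
by rewrite -mulrA [qconj q * _]mulrA S3_mulrV mul1r S3_mulrV eqxx.
Qed.
Definition S3_mul q p := UnitQuaternion (S3_mul_subproof q p).

Lemma S3_inv_subproof (q : S3) :
  (qconj q * qconj (qconj q) == 1) && (qconj (qconj q) * qconj q == 1).
Proof. by rewrite qconjK S3_mulV S3_mulrV eqxx. Qed.
Definition S3_inv q := UnitQuaternion (S3_inv_subproof q).

Lemma Lq_subproof (q : S3) :
  `[< linear (fun a : H => (q : H) * a) /\ bijective (fun a : H => (q : H) * a) >].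
Proof.
apply/asboolP; split; first by move=> t x y; rewrite mulrDr scalerAr.
by exists ( *%R (qconj q)) => a; rewrite mulrA ?S3_mulV ?S3_mulrV mul1r.
Qed.
Definition Lq q : general_linear H := GeneralLinear (Lq_subproof q).

Lemma Rq_subproof (q : S3) :
  `[< linear (fun a : H => a * (q : H)) /\ bijective (fun a : H => a * (q : H)) >].
Proof.
apply/asboolP; split; first by move=> t x y; rewrite mulrDl scalerAl.
by exists ( *%R^~ (qconj q)) => a; rewrite -mulrA ?S3_mulV ?S3_mulrV mulr1.
Qed.
Definition Rq q : general_linear H := GeneralLinear (Rq_subproof q).

Lemma Lq_M q p : (Lq q * Lq p)%g = Lq (S3_mul q p).
Proof. by apply: gl_ext => a; rewrite /= mulrA. Qed.
Lemma Lq_V q : (Lq q)^-1%g = Lq (S3_inv q).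
Proof.
apply: (@mulgI _ (Lq q)); rewrite mulgV Lq_M; apply: gl_ext => a.
by rewrite /= S3_mulV mul1r.
Qed.
Lemma Rq_M q p : (Rq q * Rq p)%g = Rq (S3_mul p q).
Proof. by apply: gl_ext => a; rewrite /= mulrA. Qed.
Lemma Rq_V q : (Rq q)^-1%g = Rq (S3_inv q).
Proof.
apply: (@mulgI _ (Rq q)); rewrite mulgV Rq_M; apply: gl_ext => a.
by rewrite /= S3_mulrV mulr1.
Qed.

(* The elements of S3L and S3R are maps, composed as in GL; in particular *)
(* Rq q * Rq p is right multiplication by p q.                            *)
Definition is_Lq : {pred general_linear H} := fun T => `[< exists q, T = Lq q >].
Definition is_Rq : {pred general_linear H} := fun T => `[< exists q, T = Rq q >].

Record S3L := MkS3L {S3L_val :> general_linear H; S3L_subproof : S3L_val \in is_Lq}.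
HB.instance Definition _ := [isSub for S3L_val].
HB.instance Definition _ := [Choice of S3L by <:].

Record S3R := MkS3R {S3R_val :> general_linear H; S3R_subproof : S3R_val \in is_Rq}.
HB.instance Definition _ := [isSub for S3R_val].
HB.instance Definition _ := [Choice of S3R by <:].

Lemma is_Lq_group_closed : group_closed is_Lq.
Proof.
split=> [|f g /asboolP[q ->] /asboolP[p ->]]; apply/asboolP.
  by exists S3_one; apply: gl_ext => a; rewrite /= mul1r.
by rewrite Lq_V Lq_M; eexists.
Qed.
HB.instance Definition _ :=
  SubChoice_isSubGroup.Build _ is_Lq S3L is_Lq_group_closed.

Lemma is_Rq_group_closed : group_closed is_Rq.
Proof.
split=> [|f g /asboolP[q ->] /asboolP[p ->]]; apply/asboolP.
  by exists S3_one; apply: gl_ext => a; rewrite /= mulr1.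
by rewrite Rq_V Rq_M; eexists.
Qed.
HB.instance Definition _ :=
  SubChoice_isSubGroup.Build _ is_Rq S3R is_Rq_group_closed.

Lemma Lq_in q : Lq q \in is_Lq. Proof. by apply/asboolP; exists q. Qed.
Definition S3L_of q : S3L := MkS3L (Lq_in q).
Lemma Rq_in q : Rq q \in is_Rq. Proof. by apply/asboolP; exists q. Qed.
Definition S3R_of q : S3R := MkS3R (Rq_in q).

Definition rho (q p : S3) (x : O) : O := Octonion (Rq q (oct1 x)) (Lq p (oct2 x)).

Lemma rhoE q p a b :
  rho q p (oct_of_quat a + omul (oct_of_quat b) e4) =
  oct_of_quat (a * (q : H)) + omul (oct_of_quat ((p : H) * b)) e4.
Proof. by rewrite -!octonionE. Qed.

End UnitQuaternions.

(* Main.v *)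
Require Import Defs.
From HB Require Import structures.
From mathcomp Require Import all_boot all_order all_algebra.
From mathcomp Require Import boolp reals.

Set Implicit Arguments.
Unset Strict Implicit.
Unset Printing Implicit Defensive.

Import GRing.Theory.
Local Open Scope ring_scope.

(** The octonionic product gives B_H(x, y) = a c^* + d^* b for x = a + b e4 and
    y = c + d e4, where ^* is quaternion conjugation.  Conjugation reverses
    products, so under rho the unit q enters only as q q^* in the middle of the
    first summand, and p only as p^* p in the middle of the second; both are 1
    ([BH_rho]).

    For the inclusion of groups, the map f, g |-> f (+) g on the two quaternion
    coordinates ([oct_sum]) is defined for arbitrary f and g in GL(H).  It is
    visibly multiplicative and injective, and it is an isometry of B_H when f is
    a right and g a left multiplication by a unit, because it then equals some
    rho q p.  Since S3R and S3L consist of maps rather than of quaternions, no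
    reversal of the order of multiplication occurs. *)

Lemma BH_rho (R : realType) (q p : S3 R) (x y : octonion R) :
  BH (rho q p x) (rho q p y) = BH x y.
Proof.
rewrite !BHE /= !qconjM.
rewrite -mulrA [(q : quaternion R) * _]mulrA S3_mulV mul1r.
by rewrite -mulrA [qconj p * _]mulrA S3_mulrV mul1r.
Qed.

Section DirectSum.
Variable R : realType.
Local Notation H := (quaternion R).
Local Notation O := (octonion R).
Implicit Types f g : general_linear H.

Lemma oct_sum_subproof f g :
  let T (x : O) := Octonion (f (oct1 x)) (g (oct2 x)) in
  `[< linear T /\ bijective T >].
Proof.
apply/asboolP; split; first by move=> t x y; rewrite /= !linearP.
exists (fun x => Octonion (gl_inv f (oct1 x)) (gl_inv g (oct2 x))) => -[a b] /=.
  by rewrite !gl_invK.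
by rewrite !gl_invVK.
Qed.
Definition oct_sum f g : general_linear O := GeneralLinear (oct_sum_subproof f g).

Lemma oct_sum_preserves (u : S3R R * S3L R) :
  oct_sum u.1 u.2 \in preserves (@BH R).
Proof.
case: u => [[f fP] [g gP]]; apply/asboolP => x y /=.
by have /asboolP[q ->] := fP; have /asboolP[p ->] := gP; exact: BH_rho.
Qed.
Definition S3RL_isometry (u : S3R R * S3L R) : isometry_group (@BH R) :=
  Isometry (oct_sum_preserves u).

Lemma S3RL_isometryM : {morph S3RL_isometry : u v / (u * v)%g}.
Proof. by move=> u v; apply: val_inj; apply: gl_ext. Qed.

Lemma S3RL_isometry1 : S3RL_isometry 1%g = 1%g.
Proof. by apply: val_inj; apply: gl_ext; case. Qed.

(** The two components are recovered by evaluating on H and on H e4. *)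
Lemma S3RL_isometry_inj : injective S3RL_isometry.
Proof.
move=> [f g] [f' g'] /(congr1 (fun T : isometry_group (@BH R) => T : O -> O)) eqT.
congr pair; apply: val_inj; apply: gl_ext => a.
  by have /(congr1 (fun S => oct1 (S (Octonion a 0)))) := eqT.
by have /(congr1 (fun S => oct2 (S (Octonion 0 a)))) := eqT.
Qed.

HB.instance Definition _ :=
  isMultiplicative.Build _ _ S3RL_isometry S3RL_isometryM.
HB.instance Definition _ :=
  Multiplicative_isUMagmaMorphism.Build _ _ S3RL_isometry S3RL_isometry1.

End DirectSum.

Theorem mainTheorem7 (R : realType) :
  (forall (q p : S3 R) (x y : octonion R),
     BH (rho q p x) (rho q p y) = BH x y) /\
  (exists Phi : UMagmaMorphism.type (S3R R * S3L R)%type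
                                    (isometry_group (@BH R)),
     injective Phi /\
     forall (q p : S3 R) (x : octonion R),
       Phi (S3R_of q, S3L_of p) x = rho q p x).
Proof.
split; first exact: BH_rho.
by exists (@S3RL_isometry R); split; first exact: S3RL_isometry_inj.
Qed.
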